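(* Let $\mathcal N$ be a finite, locally irreducible and strongly connected agent network. A configuration $\mathbf x.\mathbf q$ of $\mathcal N$ is recurrent if and only if all of the following hold: (C1) the vector $\mathbf x$ is nonnegative; (C2) the state $\mathbf q$ is locally recurrent; and (C3) every directed cycle of the rotor digraph $\varrho_{\mathbf q}$ contains a vertex in $\mathrm{supp}(\mathbf x)=\{a\in A:\mathbf x(a)\ne0\}$.
   Context: Abelian networks. $\mathbb N=\{0,1,2,\dots\}$. Let $G=(V,E)$ be a finite directed graph (self-loops and multiple edges allowed). An abelian network $\mathcal N$ on $G$ assigns to each $v\in V$ a nonempty input alphabet $A_v$ and a nonempty state space $Q_v$ (the $A_v$ pairwise disjoint), maps $T_a:Q_v\to Q_v$ for $a\in A_v$, and, for each edge $e$ from $v$ to $u$, a message-passing function $T_e:Q_v\times A_v\to A_u^*$ (free monoid of words), such that for all $v$, $a,b\in A_v$, $q\in Q_v$: $T_aT_b=T_bT_a$, and for every edge $e$ out of $v$ the words $T_e(q,a)T_e(T_a(q),b)$ and $T_e(q,b)T_e(T_b(q),a)$ agree up to permuting letters. Put $A=\bigsqcup_v A_v$, $Q=\prod_v Q_v$; $\mathcal N$ is finite if $A$ and $Q$ are finite. For a word $w\in A^*$, $|w|\in\mathbb N^A$ counts the occurrences of each letter. For $a\in A_v$, $\mathbf q\in Q$: $t_a\mathbf q$ is $\mathbf q$ with $\mathbf q(v)$ replaced by $T_a(\mathbf q(v))$, and $\mathbf M_a(\mathbf q)=\sum_{e\text{ out of }v}|T_e(\mathbf q(v),a)|\in\mathbb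 N^A$. A configuration is a pair $\mathbf x.\mathbf q$ with $\mathbf x\in\mathbb Z^A$, $\mathbf q\in Q$; $\pi_a(\mathbf x.\mathbf q)=(\mathbf x+\mathbf M_a(\mathbf q)-|a|).t_a\mathbf q$. For $w=a_1\cdots a_\ell$: $t_w=t_{a_\ell}\cdots t_{a_1}$, $\mathbf M_w(\mathbf q)=\sum_i\mathbf M_{a_i}(t_{a_1\cdots a_{i-1}}\mathbf q)$, $\pi_w=\pi_{a_\ell}\cdots\pi_{a_1}$; these depend only on $|w|$, so $t_{\mathbf n},\mathbf M_{\mathbf n},\pi_{\mathbf n}$ are defined for $\mathbf n\in\mathbb N^A$. The word $w$ is legal for $\mathbf x.\mathbf q$ if, with $\mathbf x_i.\mathbf q_i=\pi_{a_1\cdots a_i}(\mathbf x.\mathbf q)$, $\mathbf x_{i-1}(a_i)\ge1$ for all $1\le i\le\ell$. Write $\mathbf x.\mathbf q\to\mathbf x'.\mathbf q'$ if $\pi_w(\mathbf x.\mathbf q)=\mathbf x'.\mathbf q'$ for some (possibly empty) word $w$ legal for $\mathbf x.\mathbf q$. Local recurrence, kernel, production matrix. $\mathcal N$ is locally irreducible if for all $\mathbf q,\mathbf q'\in Q$ there are words $w,w'$ with $t_w\mathbf q=t_{w'}\mathbf q'$. For $\mathcal N$ finite, let $e$ be the product of all idempotents of the finite commutative monoid generated by the $t_a$ in $\mathrm{End}(Q)$; $\mathrm{Loc}(\mathcal N)=eQ$ is the set of locally recurrent states; each $t_a$ restricts to a bijection of $\mathrm{Loc}(\mathcal N)$. The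 total kernel is $K=\{\mathbf z\in\mathbb Z^A: t_{\mathbf z^+}\mathbf q=t_{\mathbf z^-}\mathbf q\ \forall\mathbf q\in\mathrm{Loc}(\mathcal N)\}$, with $\mathbf z^{\pm}\in\mathbb N^A$ the positive/negative parts of $\mathbf z$. For $\mathcal N$ finite and locally irreducible, the production matrix $P$ is the unique rational $A\times A$ matrix with $P\mathbf k=\mathbf M_{\mathbf k}(\mathbf q)$ for all $\mathbf k\in K\cap\mathbb N^A$ and $\mathbf q\in\mathrm{Loc}(\mathcal N)$. $\mathcal N$ is strongly connected if the digraph on $A$ with an edge $(a,b)$ whenever $P_{ba}>0$ is strongly connected. Agent networks and recurrence. An agent network is an abelian network with $\sum_{b\in A}\mathbf M_a(\mathbf q)(b)=1$ for all $a\in A$, $\mathbf q\in Q$ (exactly one letter is produced for each letter processed); its production matrix has spectral radius $1$. For $\mathbf q\in\mathrm{Loc}(\mathcal N)$, the rotor digraph $\varrho_{\mathbf q}$ has vertex set $A$ and edges $(a,a_{\mathbf q})$, $a\in A$, where $a_{\mathbf q}$ is the letter produced when the network in state $t_a^{-1}(\mathbf q)$ processes $a$ (with $t_a^{-1}$ the inverse of $t_a$ on $\mathrm{Loc}(\mathcal N)$). Two configurations are legally related if there is a configuration $\mathbf x_3.\mathbf q_3$ with $\mathbf x_1.\mathbf q_1\to\mathbf x_3.\mathbf q_3$ and $\mathbf x_2.\mathbf q_2\to\mathbf x_3.\mathbf q_3$. A configuration $\mathbf x.\mathbf q$ is recurrent if there is a nonempty legal execution for $\mathbf x.\mathbf q$,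 and every configuration $\mathbf x'.\mathbf q'$ legally related to $\mathbf x.\mathbf q$ satisfies $\mathbf x'.\mathbf q'\to\mathbf x.\mathbf q$. *)

(* Defs.v *)
From HB Require Import structures.
From mathcomp Require Import all_boot all_order all_algebra.

Set Implicit Arguments.
Unset Strict Implicit.
Unset Printing Implicit Defensive.

Import Order.TTheory GRing.Theory Num.Theory.
Local Open Scope ring_scope.

(* A finite abelian network.  The underlying finite directed multigraph is a
   nonempty vertex type with a finite type [edge v u] of edges from [v] to [u]
   (loops and parallel edges allowed).  Finiteness of A and Q is carried by the
   finType structures; disjointness of the alphabets by the sum type [letter]. *)
Record finAbelianNetwork := FinAbelianNetwork {
  vertex : finType;
  edge : vertex -> vertex -> finType;
  alphabet : vertex -> finType;
  local_state : vertex -> finType;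
  trans : forall v, alphabet v -> local_state v -> local_state v;
  msg : forall v u, edge v u -> local_state v -> alphabet v -> seq (alphabet u);
  vertex_gt0 : (0 < #|vertex|)%N;
  alphabet_gt0 : forall v, (0 < #|alphabet v|)%N;
  local_state_gt0 : forall v, (0 < #|local_state v|)%N;
  trans_comm : forall v (a b : alphabet v) (q : local_state v),
    trans a (trans b q) = trans b (trans a q);
  msg_comm : forall v u (e : edge v u) (a b : alphabet v) (q : local_state v),
    perm_eq (msg e q a ++ msg e (trans a q) b)
            (msg e q b ++ msg e (trans b q) a)
}.

Section Dynamics.
Variable N : finAbelianNetwork.

Definition letter : finType := {v : vertex N & alphabet v}.
Definition state : finType := {dffun forall v : vertex N, local_state v}.
Definition config : Type := ({ffun letter -> int} * state)%type.

Definition t_ (a : letter) (q : state) : state :=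
  [ffun v => dfwith q (trans (tagged a) (q (tag a))) v].

Definition M_ (a : letter) (q : state) : {ffun letter -> nat} :=
  [ffun b => \sum_(u : vertex N) \sum_(e : edge (tag a) u)
     count_mem b [seq Tagged (@alphabet N) c | c <- msg e (q (tag a)) (tagged a)]]%N.

Definition pi_ (a : letter) (c : config) : config :=
  ([ffun b => c.1 b + (M_ a c.2 b)%:Z - (b == a)%:Z], t_ a c.2).

(* Words are read from left to right: the head letter is processed first. *)
Definition t_word (w : seq letter) (q : state) : state :=
  foldl (fun p a => t_ a p) q w.

Fixpoint M_word (w : seq letter) (q : state) : {ffun letter -> nat} :=
  if w is a :: w' then [ffun b => M_ a q b + M_word w' (t_ a q) b]%N
  else [ffun=> 0%N].

Definition pi_word (w : seq letter) (c : config) : config :=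
  foldl (fun d a => pi_ a d) c w.

Fixpoint legal (w : seq letter) (c : config) : bool :=
  if w is a :: w' then (1 <= c.1 a) && legal w' (pi_ a c) else true.

Definition reaches (c c' : config) : Prop :=
  exists2 w : seq letter, legal w c & pi_word w c = c'.

(* Since [t_word w] and [M_word w] depend only on the letter counts of [w], they
   are extended to count vectors through one word with the given counts. *)
Definition word_of (n : {ffun letter -> nat}) : seq letter :=
  flatten [seq nseq (n a) a | a <- enum letter].

Definition t_vec (n : {ffun letter -> nat}) : state -> state := t_word (word_of n).

Definition M_vec (n : {ffun letter -> nat}) : state -> {ffun letter -> nat} :=
  M_word (word_of n).

Definition locally_irreducible : Prop :=
  forall q q' : state, exists w w' : seq letter, t_word w q = t_word w' q'.

Definition ffcomp (f g : {ffun state -> state}) : {ffun state -> state} :=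
  [ffun q => f (g q)].

Definition ffid : {ffun state -> state} := [ffun q => q].

(* The submonoid of End(Q) generated by the t_a: the maps reachable from the
   identity by successive composition with generators. *)
Definition transition_monoid : {set {ffun state -> state}} :=
  [set f | connect (fun g h => [exists a, h == ffcomp (finfun (t_ a)) g]) ffid f].

Definition min_idempotent : {ffun state -> state} :=
  \big[ffcomp/ffid]_(f in transition_monoid | ffcomp f f == f) f.

Definition Loc : {set state} := [set min_idempotent q | q : state].

Definition pos_part (z : {ffun letter -> int}) : {ffun letter -> nat} :=
  [ffun a => `|Num.max (z a) 0|%N].

Definition neg_part (z : {ffun letter -> int}) : {ffun letter -> nat} :=
  [ffun a => `|Num.max (- z a) 0|%N].

Definition total_kernel (z : {ffun letter -> int}) : Prop :=
  forall q : state, q \in Loc -> t_vec (pos_part z) q = t_vec (neg_part z) q.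

(* [P b a] is the entry in row [b] and column [a].  In a finite locally
   irreducible network exactly one [P] satisfies this. *)
Definition is_production_matrix (P : letter -> letter -> rat) : Prop :=
  forall (k : {ffun letter -> nat}) (q : state),
    total_kernel [ffun a => (k a)%:Z] -> q \in Loc ->
    forall b : letter, \sum_(a : letter) P b a * (k a)%:R = (M_vec k q b)%:R.

Definition strongly_connected : Prop :=
  exists P : letter -> letter -> rat,
    is_production_matrix P /\
    forall a b : letter, connect (fun c d => 0 < P d c) a b.

Definition agent_network : Prop :=
  forall (a : letter) (q : state), (\sum_(b : letter) M_ a q b = 1)%N.

(* [p] is the unique preimage of [q] under the bijection induced by [t_ a] on
   [Loc], and [b] is the letter produced by processing [a] in state [p]. *)
Definition rotor_digraph (q : state) : rel letter :=
  fun a b => [exists p in Loc, (t_ a p == q) && (M_ a p b == 1%N)].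

Definition supp (x : {ffun letter -> int}) : {set letter} := [set a | x a != 0].

Definition legally_related (c1 c2 : config) : Prop :=
  exists c3 : config, reaches c1 c3 /\ reaches c2 c3.

Definition recurrent (c : config) : Prop :=
  (exists2 w : seq letter, w != [::] & legal w c) /\
  (forall c' : config, legally_related c' c -> reaches c' c).

End Dynamics.

(* Main.v *)
Require Import Defs.
From HB Require Import structures.
From mathcomp Require Import all_boot all_order all_algebra.
From mathcomp Require Import zify.
Import Order.TTheory GRing.Theory Num.Theory.
Local Open Scope ring_scope.

(* Recurrence amounts to: some letter can be processed, and every configuration
   reachable from x.q returns to x.q.  Following one agent until it cycles yields
   a word w with t_w q = q and M_w(q) = |w|, hence P|w| = |w|; since P >= 0 is
   irreducible, w uses every letter and t_w fixes every locally recurrent state.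

   Necessity: an agent eventually enters any negative coordinate, which cannot
   become that negative again (C1); a long enough execution applies the minimal
   idempotent (C2); on a legal closed execution, the last processing of a letter
   of a rotor cycle leaves an agent on that cycle, so x does not vanish there (C3).

   Sufficiency: if x.q -> d by u, extend u to a multiple of w.  The remaining
   letters r lead from d back to x.q; they can be ordered legally, because if no
   letter of r could be processed, conservation of agents would force x = 0 on r
   and r closed under rotors, giving a rotor cycle that avoids supp x. *)

Set Implicit Arguments.
Unset Strict Implicit.
Unset Printing Implicit Defensive.

(** * Iterates of a self-map of a finite set *)

Lemma iter_fixed (T : Type) (f : T -> T) (x : T) n :
  f x = x -> iter n f x = x.
Proof. by move=> fx; elim: n => //= n ->. Qed.

(** The factorial of [#|T|] is a multiple of every cycle length and at least every preperiod, so one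
    exponent serves all [x]. *)
Lemma iter_idempotent (T : finType) (f : T -> T) :
  exists2 n, (0 < n)%N & forall x, iter n f (iter n f x) = iter n f x.
Proof.
exists (#|T|`!)%N; first exact: fact_gt0.
move=> x; set n := (#|T|`!)%N.
have /loopingP/(_ (order f x))/trajectP [i lt_io eq_i] := looping_order f x.
have leoT : (order f x <= #|T|)%N by apply: max_card.
have len : (#|T| <= n)%N := fact_geq #|T|.
have /dvdnP[m def_n] : (order f x - i %| n)%N by apply: dvdn_fact; lia.
rewrite {1}def_n iterM; apply: iter_fixed.
have [k ->] : exists k, n = (k + i)%N by exists (n - i)%N; lia.
by rewrite -iterD addnCA subnK ?(ltnW lt_io) // iterD eq_i iterD.
Qed.

(** * The abelian property *)

Section Abelian.
Variable N : finAbelianNetwork.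
Implicit Types (a b c : letter N) (w u : seq (letter N)) (q : state N).
Implicit Types (d : config N).

Lemma t_in v (a : alphabet v) q : t_ (Tagged (@alphabet N) a) q v = trans a (q v).
Proof. by rewrite ffunE dfwith_in. Qed.

Lemma t_out a q v : tag a != v -> t_ a q v = q v.
Proof. by move=> av; rewrite ffunE dfwith_out. Qed.

Lemma t_C a b q : t_ a (t_ b q) = t_ b (t_ a q).
Proof.
apply/ffunP => r.
have [ar|ar] := eqVneq (tag a) r; have [br|br] := eqVneq (tag b) r.
- case: a b ar br => [v a] [u b] /= vr ur; case: r / vr ur => ur.
  by case: v / ur a => a; rewrite !t_in trans_comm.
- by rewrite [RHS]t_out //; case: a ar => [v a] /= vr; case: r / vr br => br;
    rewrite !t_in t_out.
- by rewrite t_out //; case: b br => [v b] /= vr; case: r / vr ar => ar;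
    rewrite !t_in t_out.
by rewrite !t_out.
Qed.

Lemma M_C a c q b : (M_ a q b + M_ c (t_ a q) b = M_ c q b + M_ a (t_ c q) b)%N.
Proof.
case: a c => [v a] [u c]; rewrite !ffunE /=.
have [vu|vu] := eqVneq v u; last first.
  rewrite !dfwith_out // 1?eq_sym //.
  by rewrite addnC.
case: u / vu c => c; rewrite !dfwith_in -!big_split; apply: eq_bigr => r _.
rewrite -!big_split; apply: eq_bigr => e _ /=.
rewrite -!count_cat -!map_cat; apply/permP; apply: perm_map; exact: msg_comm.
Qed.

Lemma t_word_cat w u q : t_word (w ++ u) q = t_word u (t_word w q).
Proof. exact: foldl_cat. Qed.

Lemma t_word_rcons w a q : t_word (rcons w a) q = t_ a (t_word w q).
Proof. exact: foldl_rcons. Qed.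

Lemma pi_word_cat w u d : pi_word (w ++ u) d = pi_word u (pi_word w d).
Proof. exact: foldl_cat. Qed.

Lemma t_t_word a w q : t_ a (t_word w q) = t_word w (t_ a q).
Proof. by elim: w q => //= b w IH q; rewrite IH t_C. Qed.

Lemma t_wordC w u q : t_word w (t_word u q) = t_word u (t_word w q).
Proof. by elim: w q => //= a w IH q; rewrite t_t_word IH. Qed.

Lemma pi_2 a d : (pi_ a d).2 = t_ a d.2.
Proof. by []. Qed.

Lemma t_word_cons a w q : t_word (a :: w) q = t_word w (t_ a q).
Proof. by []. Qed.

Lemma pi_word_cons a w d : pi_word (a :: w) d = pi_word w (pi_ a d).
Proof. by []. Qed.

Lemma legal_cons a w d : legal (a :: w) d = (1 <= d.1 a) && legal w (pi_ a d).
Proof. by []. Qed.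

Lemma count_cons b a w : count_mem b (a :: w) = ((a == b) + count_mem b w)%N.
Proof. by []. Qed.

Lemma M_word_cons a w q b :
  M_word (a :: w) q b = (M_ a q b + M_word w (t_ a q) b)%N.
Proof. by rewrite /= ffunE. Qed.

Lemma M_word_nil q b : M_word [::] q b = 0%N.
Proof. by rewrite ffunE. Qed.

Lemma pi_1 a d b : (pi_ a d).1 b = d.1 b + (M_ a d.2 b)%:Z - (b == a)%:Z.
Proof. by rewrite ffunE. Qed.

Lemma M_word_cat w u q b :
  (M_word (w ++ u) q b = M_word w q b + M_word u (t_word w q) b)%N.
Proof.
elim: w q => [|a w IH] q; first by rewrite M_word_nil.
by rewrite cat_cons !M_word_cons IH addnA.
Qed.

Lemma M_word_C w u q b : M_word (w ++ u) q b = M_word (u ++ w) q b.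
Proof.
have swap1 a v p : M_word (a :: v) p b = M_word (rcons v a) p b.
  elim: v p => [|c v IH] p; first by [].
  rewrite rcons_cons (M_word_cons c (rcons v a)) -IH !M_word_cons !addnA.
  by rewrite M_C t_C.
elim: w u => [|a w IH] u; first by rewrite cats0.
by rewrite cat_cons swap1 -cats1 -catA IH -catA.
Qed.

Lemma M_word_perm w u q b : perm_eq w u -> M_word w q b = M_word u q b.
Proof.
elim: w u q => [|a w IH] u q; first by move/perm_size/esym/size0nil ->.
move=> wu; have au : a \in u by rewrite -(perm_mem wu) mem_head.
case/splitPr: au wu => u1 u2 wu.
have {}wu : perm_eq w (u1 ++ u2).
  by rewrite -(perm_cons a) (perm_trans wu) // -cat1s perm_catCA.
rewrite M_word_C cat_cons !M_word_cons (IH (u2 ++ u1)) //.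
by rewrite (perm_trans wu) // perm_catC.
Qed.

Lemma t_word_perm w u q : perm_eq w u -> t_word w q = t_word u q.
Proof.
elim: w u q => [|a w IH] u q; first by move/perm_size/esym/size0nil ->.
move=> wu; have au : a \in u by rewrite -(perm_mem wu) mem_head.
case/splitPr: au wu => u1 u2 wu.
have {}wu : perm_eq w (u1 ++ u2).
  by rewrite -(perm_cons a) (perm_trans wu) // -cat1s perm_catCA.
by rewrite t_word_cat !t_word_cons t_t_word -t_word_cat (IH _ _ wu).
Qed.

Lemma pi_word2 w d : (pi_word w d).2 = t_word w d.2.
Proof. by elim: w d => //= a w IH d; rewrite IH. Qed.

Lemma pi_word1 w d b :
  (pi_word w d).1 b = d.1 b + (M_word w d.2 b)%:Z - (count_mem b w)%:Z.
Proof.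
elim: w d => [|a w IH] d; first by rewrite M_word_nil /= addr0 subr0.
rewrite pi_word_cons IH pi_1 M_word_cons count_cons pi_2 (eq_sym b).
by lia.
Qed.

Lemma pi_word_perm w u d : perm_eq w u -> pi_word w d = pi_word u d.
Proof.
move=> wu; rewrite (surjective_pairing (pi_word w d)).
rewrite (surjective_pairing (pi_word u d)) !pi_word2 (t_word_perm _ wu).
congr (_, _); apply/ffunP => b; rewrite !pi_word1 (M_word_perm _ _ wu).
by rewrite (permP wu).
Qed.

Lemma legal_cat w u d : legal (w ++ u) d = legal w d && legal u (pi_word w d).
Proof. by elim: w d => //= a w IH d; rewrite IH andbA. Qed.

(** A legal step lowers only a coordinate that is at least 1, so no lower bound [m <= 0] is ever
    broken. *)
Lemma legal_ge w d b (m : int) :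
  m <= 0 -> m <= d.1 b -> legal w d -> m <= (pi_word w d).1 b.
Proof.
move=> m0; elim: w d => //= a w IH d mb /andP[da lw]; apply: IH => //=.
by rewrite pi_1; case: eqVneq => [eba|_] /=; [rewrite -eba in da|]; lia.
Qed.

Lemma reaches_trans d1 d2 d3 : reaches d1 d2 -> reaches d2 d3 -> reaches d1 d3.
Proof.
move=> [w lw <-] [u lu <-]; exists (w ++ u); last exact: pi_word_cat.
by rewrite legal_cat lw.
Qed.

Definition counts w : {ffun letter N -> nat} := [ffun b => count_mem b w].

Lemma perm_word_of w : perm_eq (word_of (counts w)) w.
Proof.
apply/allP => b _ /=; rewrite count_flatten -map_comp sumnE big_map big_enum /=.
rewrite (bigD1 b) //= big1 => [|a ab]; rewrite count_nseq ffunE /=.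
  by rewrite eqxx mul1n addn0.
by rewrite (negbTE ab).
Qed.

Lemma total_kernel_counts w :
  (forall q, q \in Loc N -> t_word w q = q) ->
  total_kernel [ffun a => (counts w a)%:Z].
Proof.
move=> wid q qL; rewrite /t_vec.
have -> : pos_part [ffun a => (counts w a)%:Z] = counts w.
  by apply/ffunP => a; rewrite !ffunE max_l.
have -> : neg_part [ffun a => (counts w a)%:Z] = counts [::].
  by apply/ffunP => a; rewrite !ffunE max_r //; lia.
by rewrite !(t_word_perm _ (perm_word_of _)) wid.
Qed.

Lemma production_counts P w q b : is_production_matrix P ->
  (forall q, q \in Loc N -> t_word w q = q) -> q \in Loc N ->
  \sum_a P b a * (count_mem a w)%:R = (M_word w q b)%:R.
Proof.
move=> prodP wid qL.
rewrite -(M_word_perm _ _ (perm_word_of w)) -(prodP (counts w) _ _ qL).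
  by apply: eq_bigr => a _; rewrite ffunE.
exact: total_kernel_counts.
Qed.

Lemma transition_monoid_word (f : {ffun state N -> state N}) :
  f \in transition_monoid N -> exists u, f =1 t_word u.
Proof.
rewrite inE => /connectP[p pth ->] {f}.
have : exists u, (ffid N) =1 t_word u by exists [::] => q; rewrite ffunE.
elim: p (ffid N) pth => //= g p IH f /andP[/existsP[a /eqP ->] pth] [u fu].
by apply: IH pth _; exists (rcons u a) => q; rewrite t_word_rcons !ffunE fu.
Qed.

Lemma min_idempotent_word : exists u, min_idempotent N =1 t_word u.
Proof.
pose K (f : {ffun state N -> state N}) := exists u, f =1 t_word u.
apply: (@big_ind _ K) => [|f g [u fu] [w gw]|f /andP[/transition_monoid_word]//].
  by exists [::] => q; rewrite ffunE.
by exists (w ++ u) => q; rewrite ffunE fu gw t_word_cat.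
Qed.

Lemma word_in_transition_monoid u : [ffun q => t_word u q] \in transition_monoid N.
Proof.
elim/last_ind: u => [|u a].
  by rewrite inE (_ : finfun _ = ffid N) ?connect0.
rewrite !inE => /connect_trans; apply; apply: connect1; apply/existsP; exists a.
by apply/eqP/ffunP => q; rewrite !ffunE t_word_rcons.
Qed.
End Abelian.

(** * Locally recurrent states *)

Section LocalRecurrence.
Variable N : finAbelianNetwork.
Implicit Types (a b c : letter N) (w u : seq (letter N)) (q : state N).
Implicit Types (d : config N).

(** Maps of the transition monoid are words, so they commute: [f] slides past the other factors to
    its own copy, which absorbs it. *)
Lemma min_idempotent_absorb (f : {ffun state N -> state N}) q :
  f \in transition_monoid N -> ffcomp f f = f ->
  f (min_idempotent N q) = min_idempotent N q.
Proof.
move=> fM ff; rewrite /min_idempotent; have := mem_index_enum f.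
elim: index_enum q => // g s IH q; rewrite inE big_cons.
case: ifP => [/andP[gM _]|gP].
  rewrite !ffunE => /orP[/eqP <-|fs].
    by rewrite -{3}ff ffunE.
  have [[u fu] [w gw]] := (transition_monoid_word fM, transition_monoid_word gM).
  by rewrite gw fu t_wordC -fu IH.
by case/orP => [/eqP fg|/IH //]; rewrite -fg fM ff eqxx in gP.
Qed.

Lemma t_word_nseq w n q : t_word (flatten (nseq n w)) q = iter n (t_word w) q.
Proof.
by elim: n q => //= n IH q; rewrite t_word_cat IH -iterSr.
Qed.

(** Some power of [t_word w] is an idempotent of the monoid, hence absorbed by [min_idempotent];
    this makes [t_word w] invertible on [Loc]. *)
Lemma t_word_order w :
  exists2 n, (0 < n)%N & forall q, q \in Loc N -> iter n (t_word w) q = q.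
Proof.
have [n n0 idn] := iter_idempotent (t_word w); exists n => // q /imsetP[p _ ->].
rewrite -t_word_nseq.
have := @min_idempotent_absorb _ p (word_in_transition_monoid (flatten (nseq n w))).
rewrite ffunE; apply; apply/ffunP => r.
by rewrite !ffunE !t_word_nseq idn.
Qed.

Lemma Loc_min q : min_idempotent N q \in Loc N.
Proof. exact: imset_f. Qed.

Lemma Loc_word w q : q \in Loc N -> t_word w q \in Loc N.
Proof.
move=> /imsetP[p _ ->]; have [u eu] := min_idempotent_word N.
by rewrite eu t_wordC -eu Loc_min.
Qed.

Lemma t_word_inj w : {in Loc N &, injective (t_word w)}.
Proof.
move=> q p qL pL eqw; have [[|n] // _ idn] := t_word_order w.
by rewrite -(idn q) // -(idn p) // !iterSr eqw.
Qed.

(* The transition monoid acts on [Loc] as a commutative group, transitively by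
   local irreducibility, so a map fixing one point fixes every point. *)
Lemma t_word_fix w q p : locally_irreducible N ->
  q \in Loc N -> p \in Loc N -> t_word w q = q -> t_word w p = p.
Proof.
move=> irr qL pL wq; have [u [v uv]] := irr q p.
apply: (@t_word_inj v) => //; first exact: Loc_word.
by rewrite t_wordC -uv t_wordC wq.
Qed.

(** Some power of the single letter [a] acts trivially on [Loc], so a positive multiple of column
    [a] of [P] is a vector of message counts. *)
Lemma production_ge0 P q a b : is_production_matrix P -> 0 <= P b a.
Proof.
move=> prodP; have [n n0 idn] := t_word_order [:: a].
have qL := Loc_min q; set p := min_idempotent N q in qL.
have := @production_counts _ P (flatten (nseq n [:: a])) p b prodP.
move=> /(_ _ qL); have -> : flatten (nseq n [:: a]) = nseq n a.
  by elim: (n) => //= k ->.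
rewrite (bigD1 a) //= big1 => [|c ca]; last first.
  by rewrite count_nseq /= eq_sym (negbTE ca) mulr0.
rewrite count_nseq /= eqxx mul1n addr0 => H.
have n0' : 0 < n%:R :> rat by rewrite ltr0n.
rewrite -(pmulr_lge0 _ n0') H ?ler0n // => r rL.
have <- : flatten (nseq n [:: a]) = nseq n a by elim: (n) => //= k ->.
by rewrite t_word_nseq idn.
Qed.

(* The letter counts [k] of [w] satisfy [P k = k], and the support of such a [k]
   is closed under the edges of the strongly connected digraph of [P]. *)
Lemma closed_word w q : locally_irreducible N -> strongly_connected N ->
  w != [::] -> t_word w q = q -> (forall b, M_word w q b = count_mem b w) ->
  (forall b, b \in w) /\
  (forall p, p \in Loc N ->
     t_word w p = p /\ forall b, M_word w p b = count_mem b w).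
Proof.
move=> irr [P [prodP conn]] w0 wq Mw.
pose p0 := min_idempotent N q; have p0L : p0 \in Loc N by exact: Loc_min.
have [u eu] := min_idempotent_word N.
have wp0 : t_word w p0 = p0 by rewrite /p0 eu t_wordC wq.
have wL p : p \in Loc N -> t_word w p = p by move=> pL; exact: t_word_fix wp0.
have Mp0 b : M_word w p0 b = count_mem b w.
  (* Comparing [w ++ u] with [u ++ w] from [q] carries the balance of [w] over to [p0]. *)
  have := M_word_C w u q b; rewrite !M_word_cat wq -eu -/p0 addnC Mw.
  by move/addnI.
have Pw b : \sum_a P b a * (count_mem a w)%:R = (count_mem b w)%:R.
  by rewrite (production_counts _ prodP wL p0L) Mp0.
split=> [b|p pL]; last first.
  split=> [|b]; first exact: wL.
  by apply/eqP; rewrite -(eqr_nat rat) -(production_counts _ prodP wL pL) Pw.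
have step a c : a \in w -> 0 < P c a -> c \in w.
  (* Row [c] of [P k = k] has a positive term at [a] and no negative term. *)
  move=> aw Pca; rewrite -has_pred1 has_count -(ltr0n rat) -Pw.
  rewrite (bigD1 a) //= ltr_pwDl //.
    by rewrite mulr_gt0 // ltr0n -has_count has_pred1.
  by apply: sumr_ge0 => i _; rewrite mulr_ge0 ?ler0n ?(production_ge0 q).
case: w w0 step {wq Mw wp0 wL Mp0 Pw} => // a w _ step.
have /connectP[s pth ->] := conn a b.
move: {w}(a :: w) (mem_head a w) step => w aw step.
elim: s a pth aw => //= c s IH e /andP[Pce pth] ew.
by apply: IH pth _; apply: step Pce.
Qed.

End LocalRecurrence.

(** * Agent networks *)

Section Agent.
Variable N : finAbelianNetwork.
Implicit Types (a b c : letter N) (w u r : seq (letter N)) (q p : state N).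
Implicit Types (d : config N) (s : letter N * state N) (x : {ffun letter N -> int}).

Hypothesis agent : agent_network N.

(* The default value [s.1] is never reached in an agent network. *)
Definition agent_step s : letter N * state N :=
  (odflt s.1 [pick b | M_ s.1 s.2 b == 1%N], t_ s.1 s.2).

Lemma agent_stepE s b : M_ s.1 s.2 b = (b == (agent_step s).1).
Proof.
have /eqP/sum_nat_eq1[c [_ Mc M0]] := agent s.1 s.2.
rewrite /agent_step; case: pickP => [e /eqP Me|/(_ c)]; last by rewrite Mc.
have ec : e = c by have [//|/M0/(_ isT)] := eqVneq e c; rewrite Me.
by rewrite ec /=; case: eqVneq => [->|/M0/(_ isT) ->].
Qed.

Lemma M_word_sum w q : (\sum_b M_word w q b = size w)%N.
Proof.
elim: w q => [|a w IH] q; first by rewrite big1 // => b _; rewrite M_word_nil.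
under eq_bigr do rewrite M_word_cons.
by rewrite big_split /= agent IH.
Qed.

(** * Walks of a single agent *)

Definition walk n s : seq (letter N) := map fst (traject agent_step s n).

Lemma walkS n s : walk n.+1 s = s.1 :: walk n (agent_step s).
Proof. by []. Qed.

Lemma walkD m n s : walk (m + n) s = walk m s ++ walk n (iter m agent_step s).
Proof.
by rewrite /walk trajectD map_cat.
Qed.

Lemma t_walk n s : t_word (walk n s) s.2 = (iter n agent_step s).2.
Proof. by elim: n s => // n IH s; rewrite walkS t_word_cons IH iterSr. Qed.

(** Each letter produced is the next one processed, so only the endpoints fail to cancel. *)
Lemma M_walk n s b :
  (M_word (walk n s) s.2 b + (b == s.1) =
   count_mem b (walk n s) + (b == (iter n agent_step s).1))%N.
Proof.
elim: n s => [|n IH] s; first by rewrite M_word_nil.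
rewrite walkS M_word_cons count_cons iterSr (eq_sym _ b) agent_stepE.
rewrite -[t_ s.1 s.2]/(agent_step s).2 [X in (X + _)%N]addnC IH.
by rewrite addnC addnA.
Qed.

Lemma pi_walk n s x b :
  (pi_word (walk n s) (x, s.2)).1 b =
  x b + (b == (iter n agent_step s).1)%:Z - (b == s.1)%:Z.
Proof.
rewrite pi_word1 -[(x, s.2).1]/x -[(x, s.2).2]/s.2; have := M_walk n s b.
by move: (M_word _ _ b) (count_mem b _) (nat_of_bool _) (nat_of_bool _); lia.
Qed.

Lemma legal_walk n s x :
  (forall i, (i < n)%N -> 0 <= x (iter i agent_step s).1) -> 1 <= x s.1 ->
  legal (walk n s) (x, s.2).
Proof.
elim: n s x => // n IH s x x0 xs; rewrite walkS legal_cons xs /=.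
(* Nothing is assumed about the letter where the walk ends, so a one-step walk is settled
   separately. *)
case: n IH x0 => // n IH x0.
have pi1 b : (pi_ s.1 (x, s.2)).1 b =
    x b + (b == (agent_step s).1)%:Z - (b == s.1)%:Z.
  by rewrite pi_1 agent_stepE.
rewrite [pi_ _ _]surjective_pairing; apply: IH => [i lt_in|].
  rewrite pi1 -iterSr; have := x0 i.+1 lt_in.
  move: (iter _ _ _).1 => c; move: (nat_of_bool (c == _.1)) => k.
  by have [->|_] := eqVneq c s.1; lia.
rewrite pi1 eqxx; have := x0 1%N isT; rewrite -[iter _ _ _]/(agent_step s).
by have [->|_] := eqVneq (agent_step s).1 s.1; lia.
Qed.

Hypothesis irr : locally_irreducible N.
Hypothesis conn : strongly_connected N.

Lemma closed_walk : exists2 n, (0 < n)%N & forall s,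
  exists2 s', iter n agent_step s = s' &
  [/\ walk n s' != [::], t_word (walk n s') s'.2 = s'.2 &
      forall b, M_word (walk n s') s'.2 b = count_mem b (walk n s')].
Proof.
have [n n0 idn] := iter_idempotent agent_step; exists n => // s.
exists (iter n agent_step s) => //; set s' := iter n _ s.
split=> [||b]; first by case: (n) n0.
  by rewrite t_walk idn.
by have := M_walk n s' b; rewrite idn; move/addIn.
Qed.

Lemma walk_cover : exists n, forall s b, b \in walk n s.
Proof.
(* The first [n] steps lead into a cycle of [agent_step]; the next [n] spell a closed word, which
   uses every letter. *)
have [n _ cl] := closed_walk; exists (n + n)%N => s b.
have [s' def_s' [w0 tw Mw]] := cl s.
rewrite walkD mem_cat def_s'; have [-> //] := closed_word irr conn w0 tw Mw.
by rewrite orbT.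
Qed.

(** A covering walk processes every letter and leaves an agent at its end, where the next covering
    walk starts. *)
Lemma legal_fill n d a : (forall b, 0 <= d.1 b) -> 1 <= d.1 a ->
  exists2 w, legal w d & forall b, (n <= count_mem b w)%N.
Proof.
have [m cover] := walk_cover.
elim: n d a => [|n IH] [x q] a x0 xa; first by exists [::].
pose w := walk m (a, q).
have lw : legal w (x, q) by apply: legal_walk => // i _; exact: x0.
have [||u lu nu] := IH (pi_word w (x, q)) (iter m agent_step (a, q)).1.
- by move=> b; apply: legal_ge.
- rewrite (pi_walk m (a, q)) eqxx -[(a, q).1]/a.
  move: (iter _ _ _).1 => c; have := x0 c; rewrite -[(x, q).1]/x.
  by have [->|_] := eqVneq c a; move: xa; rewrite -[(x, q).1]/x; lia.
exists (w ++ u); first by rewrite legal_cat lw.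
move=> b; rewrite count_cat -add1n leq_add //.
by rewrite -has_count has_pred1 cover.
Qed.

(** Each copy of a closed word contains every letter, so [size u] copies contain [u]; [a] and [q]
    only start the walk that yields the closed word. *)
Lemma kernel_word u a q : exists w r, [/\ perm_eq (u ++ r) w,
  forall p, p \in Loc N -> t_word w p = p &
  forall p b, p \in Loc N -> M_word w p b = count_mem b w].
Proof.
have [n n0 cl] := closed_walk; have [s' _ [w0 tw Mw]] := cl (a, q).
have [all_w fixL] := closed_word irr conn w0 tw Mw.
move: (walk n s') all_w fixL => v all_v fixL {n n0 cl s' w0 tw Mw}.
pose w := flatten (nseq (size u) v).
have /count_subseqP[u' /perm_to_subseq[r wr] uu'] :
    forall b, (count_mem b u <= count_mem b w)%N.
  move=> b; apply: leq_trans (count_size _ _) _; rewrite /w.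
  elim: (size u) => //= k IH; rewrite count_cat -add1n leq_add //.
  by rewrite -has_count has_pred1.
exists w, r; split.
- by rewrite perm_sym (perm_trans wr) // perm_cat2r perm_sym.
- move=> p pL; rewrite t_word_nseq; apply: iter_fixed.
  by have [] := fixL p pL.
move=> p b pL; have [tv Mv] := fixL p pL; rewrite /w.
elim: (size u) => [|k IH]; first by rewrite M_word_nil.
by rewrite /= M_word_cat tv IH count_cat Mv.
Qed.

(** If [d'] and [d] both reach [e], a return from [e] to [d] also brings [d'] to [d]. *)
Lemma recurrentE d : recurrent d <->
  (exists a, 1 <= d.1 a) /\ forall d', reaches d d' -> reaches d' d.
Proof.
split=> [[[[|a w] // _ /andP[da _]] rel]|[[a da] ret]].
  split=> [|d' dd']; first by exists a.
  by apply: rel; exists d'; split=> //; exists [::].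
split=> [|d' [e [d'e de]]]; first by exists [:: a]; rewrite //= da.
by apply: reaches_trans d'e _; apply: ret.
Qed.

Section Recurrent.
Variables (x : {ffun letter N -> int}) (q : state N).

(** * Necessity of (C1) and (C2) *)

Section Necessity.
Hypothesis rec : recurrent (x, q).

(* An agent launched from a positive letter eventually enters a negative one, and
   a legal execution never undoes the increase of a negative coordinate. *)
Lemma recurrent_ge0 b : 0 <= x b.
Proof.
have /recurrentE[[a xa] ret] := rec.
rewrite leNgt; apply/negP => xb.
have [m cover] := walk_cover.
have /mapP[s1 /trajectP[i _ ->] def_b] := cover (a, q) b.
have ex_neg : exists n, x (iter n agent_step (a, q)).1 < 0.
  by exists i; rewrite -def_b.
case: (ex_minnP ex_neg) => {i def_b ex_neg} n neg minn.
set c := (iter n agent_step (a, q)).1 in neg.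
have ca : c != a.
  by apply: contraTneq neg => ->; rewrite -leNgt; apply: le_trans xa.
have lw : legal (walk n (a, q)) (x, q).
  apply: legal_walk => // i lt_in; rewrite leNgt; apply/negP => /minn; lia.
have [|u lu def_xq] := ret (pi_word (walk n (a, q)) (x, q)).
  by exists (walk n (a, q)).
(* After the walk, coordinate [c] equals [x c + 1 <= 0], a bound that the return [u] cannot
   break. *)
have := @legal_ge _ u (pi_word (walk n (a, q)) (x, q)) c (x c + 1) _ _ lu.
rewrite def_xq (pi_walk n (a, q)) -/c eqxx -[(x, q).1]/x -[(a, q).1]/a.
by rewrite (negbTE ca); move: neg; lia.
Qed.

Lemma recurrent_Loc : q \in Loc N.
Proof.
have /recurrentE[[a xa] ret] := rec.
have [u eu] := min_idempotent_word N.
(* [size u] bounds every letter count of [u], so [w] can be reordered to apply [min_idempotent]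
   first. *)
have [w lw sw] := @legal_fill (size u) (x, q) a recurrent_ge0 xa.
have [|v lv def_xq] := ret (pi_word w (x, q)); first by exists w.
have /count_subseqP[u' /perm_to_subseq[r wr] uu'] :
    forall b, (count_mem b u <= count_mem b w)%N.
  by move=> b; apply: leq_trans (sw b); exact: count_size.
have {def_xq} <- : t_word v (t_word w q) = q.
  by have := congr1 snd def_xq; rewrite !pi_word2.
rewrite (t_word_perm _ wr) t_word_cat -(t_word_perm _ uu') -eu.
by do 2!apply: Loc_word; exact: Loc_min.
Qed.

End Necessity.

(** Stands in for rotor cycles: the vertices of a cycle form such a set, and a nonempty one contains
    a cycle. *)
Definition rotor_closed (S : pred (letter N)) :=
  forall a, S a -> exists2 b, S b & rotor_digraph q a b.

(* By the abelian property, deferring the last processing of a letter [a] of [S]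
   to the end shows that it sends its agent into [S], where it stays. *)
Lemma rotor_closed_unvisited (S : pred (letter N)) w d :
  rotor_closed S -> (forall b, S b -> x b = 0) ->
  (forall b, 0 <= d.1 b) -> d.2 \in Loc N -> legal w d -> pi_word w d = (x, q) ->
  forall b, b \in w -> ~~ S b.
Proof.
move=> clS xS; elim: w d => // a w IH [y p] y0 pL; rewrite legal_cons pi_word_cons.
move=> /andP[ya lw] def_xq.
have d0 b : 0 <= (pi_ a (y, p)).1 b.
  by apply: (@legal_ge _ [:: a]); rewrite //= ya.
have notS : forall b, b \in w -> ~~ S b.
  by apply: IH def_xq => //; apply: (@Loc_word _ [:: a]).
move=> b; rewrite inE => /orP[/eqP ->|]; last exact: notS.
apply/negP => /clS[c Sc /existsP[p' /andP[p'L /andP[/eqP tp' /eqP Mp']]]].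
have def_p' : t_word w p = p'.
  apply: (@t_word_inj _ [:: a]); rewrite ?Loc_word //=.
  rewrite tp' t_t_word -[RHS]/(x, q).2 -def_xq pi_word2 //.
have xc : x c = (pi_ a (y, p)).1 c + (M_word w (t_ a p) c)%:Z - (count_mem c w)%:Z.
  by rewrite -[x]/(x, q).1 -def_xq pi_word1.
have cw : count_mem c w = 0%N.
  by apply/count_memPn/negP => /notS; rewrite Sc.
(* [c] gains an agent and [w] never processes it; if [c = a], the agent in [ya] pays for processing
   [a]. So [x c > 0]. *)
have := M_word_C [:: a] w p c.
rewrite !M_word_cat !M_word_cons !M_word_nil def_p' Mp' -[t_word _ _]/(t_ a p).
move: xc (xS c Sc) (y0 c) ya; rewrite pi_1 cw -[(y, p).1]/y -[(y, p).2]/p.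
move: (M_word w _ c) (M_ a p c) => m k.
by have [->|_] := eqVneq c a; lia.
Qed.

(** Iterating a choice [f] of rotor successors within [S] ends on a periodic orbit. *)
Lemma rotor_closed_cycle (S : pred (letter N)) a : rotor_closed S -> S a ->
  exists l, [/\ l != [::], ucycle (rotor_digraph q) l & all S l].
Proof.
move=> clS Sa.
pose f b := odflt b [pick c | S c && rotor_digraph q b c].
have fP b : S b -> S (f b) && rotor_digraph q b (f b).
  move=> Sb; rewrite /f; case: pickP => //= noc.
  by have [c Sc bc] := clS b Sb; have := noc c; rewrite Sc bc.
have Sf n b : S b -> S (iter n f b).
  by move=> Sb; elim: n => //= n /fP/andP[].
have [n n0 idn] := iter_idempotent f; pose b := iter n f a.
have Sb : S b by apply: Sf.
have So : all S (orbit f b).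
  by apply/allP => c /trajectP[i _ ->]; apply: Sf.
exists (orbit f b); split=> //.
  by rewrite -size_eq0 size_orbit -lt0n order_gt0.
rewrite /ucycle orbit_uniq andbT.
apply: (@sub_in_cycle _ S (frel f)) So _.
  by move=> c e Sc _ /eqP <-; have /andP[] := fP c Sc.
by apply/(orbitPcycle 3 0)%N; exists n.-1; rewrite prednK // idn.
Qed.

(* If no letter of [r] can be processed, letter counts force [x] to vanish on [r]
   and [r] to be closed under rotors. *)
Lemma legal_rearrangement r d :
  (forall S, rotor_closed S -> (forall b, S b -> x b = 0) -> forall b, ~~ S b) ->
  (forall b, 0 <= x b) ->
  (forall b, 0 <= d.1 b) -> d.2 \in Loc N -> pi_word r d = (x, q) ->
  exists2 r', perm_eq r' r & legal r' d.
Proof.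
move=> noS x0; have [n] := ubnP (size r); elim: n r d => // n IH r [y p].
have [/hasP[a ar ya]|/hasPn stuck] := boolP (has (fun a => 1 <= y a) r).
  move=> lt_rn y0 pL def_xq.
  have ra := perm_to_rem ar.
  have [||||r' pr lr] := IH (rem a r) (pi_ a (y, p)).
  - by have := perm_size ra; rewrite /= in lt_rn *; lia.
  - by move=> b; apply: (@legal_ge _ [:: a]); rewrite //= ya.
  - exact: (@Loc_word _ [:: a]).
  - by rewrite -pi_word_cons -(pi_word_perm _ ra).
  exists (a :: r'); last by rewrite legal_cons ya.
  by rewrite perm_sym (perm_trans ra) // perm_cons perm_sym.
move=> _ y0 pL def_xq.
suff r0 : r = [::] by exists [::]; rewrite ?r0.
have xE b : x b = y b + (M_word r p b)%:Z - (count_mem b r)%:Z.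
  by rewrite -[x]/(x, q).1 -def_xq pi_word1.
have yr b : b \in r -> y b = 0 by move=> /stuck; have := y0 b; rewrite /=; lia.
(* A letter of [r] starts at 0 and ends nonnegative, so it is produced at least as often as
   processed; the totals agree, which forces equality. *)
have ME b : M_word r p b = count_mem b r.
  have le c : (count_mem c r <= M_word r p c)%N.
    have [cr|] := boolP (c \in r); last by move/count_memPn ->.
    by have := xE c; rewrite yr //; have := x0 c; lia.
  have := @leqif_sum _ predT (fun c => count_mem c r == M_word r p c)
    (fun c => count_mem c r) (M_word r p) (fun c _ => leqif_eq (le c)).
  rewrite M_word_sum => -[_]; rewrite (_ : (\sum_c _)%N = size r).
    by rewrite eqxx => /esym/forallP/(_ b)/eqP.
  elim: (r) => [|a v IHv]; first by rewrite big1.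
  under eq_bigr do rewrite count_cons.
  rewrite big_split /= IHv (bigD1 a) //= eqxx big1 // => c /negbTE.
  by rewrite eq_sym => ->.
have xr b : b \in r -> x b = 0 by move=> br; rewrite xE ME yr //; lia.
have clr : rotor_closed (mem r).
  move=> a ar; have ra := perm_to_rem ar.
  set p' := t_word (rem a r) p.
  have tp' : t_ a p' = q.
    by rewrite -[q]/(x, q).2 -def_xq pi_word2 (t_word_perm _ ra) /= t_t_word.
  have Mp' := agent_stepE (a, p'); set b := (agent_step _).1 in Mp'.
  exists b; last first.
    apply/existsP; exists p'; rewrite Loc_word // tp' eqxx.
    by have := Mp' b => /= ->; rewrite eqxx.
  (* Processed last, [a] produces [b]; by [ME], [b] then occurs in [r]. *)
  rewrite /= -has_pred1 has_count -ME (M_word_perm _ _ ra) -cat1s M_word_C.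
  rewrite M_word_cat M_word_cons -/p' addnA.
  by have := Mp' b => /= ->; rewrite eqxx; lia.
case: r {stuck def_xq xE yr ME} xr clr => // a r xr clr.
by have := noS _ clr xr a; rewrite /= mem_head.
Qed.

End Recurrent.
End Agent.

Theorem theorem7p4 (N : finAbelianNetwork)
    (x : {ffun letter N -> int}) (q : state N) :
  locally_irreducible N -> strongly_connected N -> agent_network N ->
  recurrent (x, q) <->
  [/\ forall a : letter N, 0 <= x a,
      q \in Loc N &
      forall c : seq (letter N), c != [::] -> ucycle (rotor_digraph q) c ->
        exists2 a : letter N, a \in c & a \in supp x].
Proof.
move=> irr conn agent; split=> [rec|[x0 qL cyc]].
  have x0 := recurrent_ge0 agent irr conn rec.
  have qL := recurrent_Loc agent irr conn rec.
  split=> // c c0 /andP[cycle_c _].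
  have [/hasP[a]|/hasPn c_out] := boolP (has (mem (supp x)) c); first by exists a.
  have clc : rotor_closed q (mem c).
    by move=> a ac; exists (next c a); [rewrite /= mem_next | exact: next_cycle].
  have xc b : b \in c -> x b = 0.
    by move=> /c_out; rewrite /= inE negbK => /eqP.
  have /recurrentE[[a xa] ret] := rec.
  (* Processing every letter once makes the closed execution meet the cycle [c]. *)
  have [w lw cw] := @legal_fill _ agent irr conn 1 (x, q) a x0 xa.
  have [|v lv def_xq] := ret (pi_word w (x, q)); first by exists w.
  have lwv : legal (w ++ v) (x, q) by rewrite legal_cat lw.
  rewrite -pi_word_cat in def_xq.
  have out := @rotor_closed_unvisited _ x q _ _ (x, q) clc xc x0 qL lwv def_xq.
  case: c c0 {cycle_c c_out clc xc} out => // b c _ out.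
  have bwv : b \in w ++ v by rewrite mem_cat -has_pred1 has_count cw.
  by have /negP[] := out b bwv; exact: mem_head.
have noS (S : pred (letter N)) : rotor_closed q S -> (forall b, S b -> x b = 0) ->
    forall b, ~~ S b.
  move=> clS xS b; apply/negP => /(rotor_closed_cycle clS)[c [c0 cc /allP Sc]].
  by have [a ac] := cyc c c0 cc; rewrite inE (xS a (Sc a ac)) eqxx.
have [v _] := card_gt0P (vertex_gt0 N); have [a0 _] := card_gt0P (alphabet_gt0 v).
pose l : letter N := Tagged (@alphabet N) a0.
(* Every letter has a rotor successor, so a rotor cycle exists and (C3) yields a letter that can be
   processed. Applying [t_ a] another [n.-1] times inverts it on [Loc]. *)
have clT : rotor_closed q predT.
  move=> a _; have [n n0 idn] := t_word_order [:: a].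
  pose p := t_word (flatten (nseq n.-1 [:: a])) q.
  exists (agent_step (a, p)).1 => //; apply/existsP; exists p.
  rewrite Loc_word // (agent_stepE agent (a, p)) eqxx andbT.
  rewrite /p t_word_nseq andTb; apply/eqP.
  by rewrite -[LHS]/(iter n.-1.+1 (t_word [:: a]) q) prednK // idn.
apply/recurrentE; split=> [|d' [u lu ud]].
  have [c [c0 cc _]] := rotor_closed_cycle clT (isT : predT l).
  have [a _] := cyc c c0 cc; rewrite inE => xa.
  by exists a; have := x0 a; rewrite -[(x, q).1]/x; lia.
have [w [r [urw wid Mw]]] := kernel_word agent irr conn u l q.
have rd : pi_word r d' = (x, q).
  rewrite -ud -pi_word_cat (pi_word_perm _ urw) [LHS]surjective_pairing.
  rewrite pi_word2 wid //; congr (_, _); apply/ffunP => b.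
  by rewrite pi_word1 Mw // addrK.
have [||r' pr lr] := legal_rearrangement agent noS x0 _ _ rd.
- by move=> b; rewrite -ud; apply: legal_ge.
- by rewrite -ud pi_word2 Loc_word.
by exists r'; rewrite ?(pi_word_perm _ pr).
Qed.
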